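(* Let $\mathcal H$ have dimension $d\ge2$ and let $\mathcal L_{\rm depol}(X)=\mathrm{Tr}(X/d)\,\mathbf 1-X$ be the generator of the depolarizing semigroup. Then for every $p\in(1,2]$ its optimal $p$-Beckner constant satisfies $$\frac p4\ \le\ \alpha_p(\mathcal L_{\rm depol})\ \le\ \min\Big\{\frac12,\ \frac{p\,d^{p-1}}{4(d^{p-1}-1)}\Big\}.$$
   Context: $\mathcal L_{\rm depol}$ generates the semigroup $\mathcal P_t(X)=e^{-t}X+(1-e^{-t})\frac{\mathrm{Tr}(X)}{d}\mathbf 1$ on $\mathcal B(\mathcal H)$, with unique invariant state $\mathbf 1/d$. For $X\ge0$ and $p>0$ put $\|X\|_{p,\mathbf 1/d}=\big(\tfrac1d\mathrm{Tr}(X^p)\big)^{1/p}$, and for $p>1$, with $\hat p=p/(p-1)$, $$\mathcal E_{p,\mathcal L_{\rm depol}}(X)=-\frac{\hat p\,p}{4}\cdot\frac1d\,\mathrm{Tr}\big(X^{p-1}\mathcal L_{\rm depol}(X)\big).$$ The optimal $p$-Beckner constant $\alpha_p(\mathcal L_{\rm depol})$ is the largest constant $\alpha_p$ such that $$\alpha_p\,\hat p\,\big(\|X\|_{p,\mathbf 1/d}^p-\|X\|_{1,\mathbf 1/d}^p\big)\le\mathcal E_{p,\mathcal L_{\rm depol}}(X)\qquad\text{for all }X>0.$$ *)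

(* Defs.v *)
From HB Require Import structures.
From mathcomp Require Import all_boot all_order all_algebra.
From mathcomp Require Import complex.
From mathcomp Require Import all_classical all_reals all_analysis.

Set Implicit Arguments.
Unset Strict Implicit.
Unset Printing Implicit Defensive.

Import Order.TTheory GRing.Theory Num.Theory.

Local Open Scope ring_scope.
Local Open Scope complex_scope.
Local Open Scope sesquilinear_scope.
Local Open Scope classical_set_scope.

Section Beckner.
Variables (R : realType) (d : nat).

Implicit Types (X : 'M[R[i]]_d) (L : 'M[R[i]]_d -> 'M[R[i]]_d) (p a : R).

(* The order of R[i] is partial: 0 < z means that z is real and positive. *)
Definition posdefmx X : Prop :=
  X \is hermsymmx /\
  (forall v : 'cV[R[i]]_d, v != 0 -> 0 < (v^t* *m X *m v) 0 0).

(* Functional calculus: the unitary P := spectralmx X satisfies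
   X = P^-1 *m diag_mx (spectral_diag X) *m P for normal X, and the entries of
   spectral_diag X are real when X is Hermitian.  The matrix mxpowR X p is only
   meaningful for positive semidefinite X. *)
Definition mxpowR X p : 'M[R[i]]_d :=
  invmx (spectralmx X)
    *m diag_mx (map_mx (fun z => (complex.Re z `^ p)%:C) (spectral_diag X))
    *m spectralmx X.

(* The normalized trace.  It is real on all the arguments used below when L
   preserves Hermitian matrices, so that taking the real part loses nothing. *)
Definition ntr X : R := d%:R^-1 * complex.Re (\tr X).

Definition pnorm p X : R := ntr (mxpowR X p) `^ p^-1.

Definition conj_exp p : R := p / (p - 1).

Definition dirichlet_form p L X : R :=
  - (conj_exp p * p / 4) * ntr (mxpowR X (p - 1) *m L X).

Definition beckner_set p L : set R :=
  [set a | forall X, posdefmx X ->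
     a * conj_exp p * (pnorm p X `^ p - pnorm 1 X `^ p)
       <= dirichlet_form p L X].

(* a is the largest element of beckner_set p L; it is unique by antisymmetry. *)
Definition optimal_beckner_constant p L a : Prop :=
  beckner_set p L a /\ ubound (beckner_set p L) a.

Definition Ldepol X : 'M[R[i]]_d := (\tr (d%:R^-1 *: X))%:M - X.

End Beckner.

Arguments Ldepol R d X : clear implicits.

(* Main.v *)
Require Import Defs.
From HB Require Import structures.
From mathcomp Require Import all_boot all_order all_algebra.
From mathcomp Require Import complex.
From mathcomp Require Import all_classical all_reals all_analysis.
From mathcomp Require Import ring lra.

(**
Both sides of the Beckner inequality for [Ldepol] depend only on the spectrum
of X.  With eigenvalues x_1, ..., x_d and m_q the mean of the x_i ^ q, the
factor p / (p - 1) cancels and the inequality reads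
  a * (m_p - m_1 ^ p) <= p / 4 * (m_p - m_1 * m_(p-1)).
Every positive vector x is the spectrum of a positive definite diagonal matrix,
so the problem is one about positive vectors ([beckner_setE]).

Lower bound.  As 0 < p - 1 <= 1, Jensen's inequality for the concave power
p - 1 gives m_(p-1) <= m_1 ^ (p-1), hence m_1 * m_(p-1) <= m_1 ^ p, and
a = p / 4 is admissible ([moment_beckner_p4]).

Upper bound 1/2.  At x = (1 + e, 1 - e, 1, ..., 1) both sides are of order
e ^ 2.  Up to the factor 1 / d the left side is at least a * p (p - 1) e ^ 2 and the
right side is at most p / 4 * (p - 1) e ^ 2 * (1 + 1 / (1 - e)), which forces
a <= 1/2 as e tends to 0 ([moment_beckner_le_half]).

Upper bound p d^(p-1) / (4 (d^(p-1) - 1)).  For the rank-one projection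
x = (1, 0, ..., 0), and after multiplication by d ^ p, the inequality becomes
a * (d^(p-1) - 1) <= p / 4 * (d^(p-1) - d^(p-2)), which is stronger than needed.
The gap d^(p-2) pays for replacing the zeros by a small positive number that is
explicit in d ([moment_beckner_le_near_rank1]).

The optimal constant exists because the admissible set contains p / 4, is
bounded above by 1/2, and is cut out by non-strict linear inequalities in a,
hence is closed and contains its supremum.
*)

Set Implicit Arguments.
Unset Strict Implicit.
Unset Printing Implicit Defensive.

Import Order.TTheory GRing.Theory Num.Theory.

Local Open Scope ring_scope.

(** * Elementary inequalities for real powers *)

Section PowerInequalities.
Import numFieldNormedType.Exports.
Local Open Scope classical_set_scope.
Local Open Scope ring_scope.

Variable R : realType.
Implicit Types p q s t e b c : R.

(** Bernoulli's inequality for concave powers: the graph lies below its tangent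
at 1.  It is Young's inequality for t ^ q and 1 with exponents 1 / q and
1 / (1 - q). *)
Lemma powR_le_tangent q t : 0 < q -> q <= 1 -> 0 <= t ->
  t `^ q <= 1 + q * (t - 1).
Proof.
move=> q0; rewrite le_eqVlt => /predU1P[-> t0|q1 t0].
  by rewrite powRr1 //; lra.
have q1' : 0 < 1 - q by lra.
have := @conjugate_powR R (t `^ q) 1 q^-1 (1 - q)^-1.
rewrite -powRrM mulfV ?gt_eqF// powRr1 // powR1 mulr1 !invrK.
move=> /(_ (powR_ge0 _ _) ler01); rewrite !invr_gt0 => /(_ q0 q1').
have -> : q + (1 - q) = 1 by ring.
by move=> /(_ erefl); lra.
Qed.

(** The previous bound at 1 / t: the weighted geometric mean of t and 1
dominates their weighted harmonic mean. *)
Lemma powR_ge_harmonic q t : 0 < q -> q <= 1 -> 0 < t ->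
  t / (t + q * (1 - t)) <= t `^ q.
Proof.
move=> q0 q1 t0.
have den : 0 < t + q * (1 - t).
  rewrite [ltRHS](_ : _ = q + t * (1 - q)); last by ring.
  by apply: ltr_wpDr => //; rewrite mulr_ge0 ?subr_ge0// ltW.
have := @powR_le_tangent q t^-1 q0 q1; rewrite invr_ge0 => /(_ (ltW t0)).
rewrite -(powR_inv1 (ltW t0)) powRAC powR_inv1 ?powR_ge0//.
rewrite (powR_inv1 (ltW t0)) => H.
rewrite -[leRHS]invrK -[leLHS]invrK.
rewrite lef_pV2 ?posrE ?invr_gt0 ?powR_gt0 ?divr_gt0//.
by rewrite [leRHS](_ : _ = 1 + q * (t^-1 - 1))//; field; rewrite !gt_eqF.
Qed.

(** The right-hand side is 2 q e to leading order as e tends to 0; an explicit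
error term replaces the limit. *)
Lemma powR_sub_le q e : 0 < q -> q <= 1 -> 0 < e -> e < 1 ->
  (1 + e) `^ q - (1 - e) `^ q <= q * e * (1 + (1 - e)^-1).
Proof.
move=> q0 q1 e0 e1.
have e1' : 0 < 1 - e by lra.
have plus : (1 + e) `^ q <= 1 + q * (1 + e - 1).
  by apply: powR_le_tangent => //; lra.
have minus := powR_ge_harmonic q0 q1 e1'.
have den : 0 < 1 - e + q * e by apply: addr_gt0 => //; apply: mulr_gt0.
rewrite opprB addrCA addrN addr0 in minus.
have split_frac : (1 - e) / (1 - e + q * e) = 1 - q * e / (1 - e + q * e).
  by field; rewrite (gt_eqF den).
have le_frac : q * e / (1 - e + q * e) <= q * e / (1 - e).
  rewrite ler_pM2l ?mulr_gt0// lef_pV2 ?posrE//.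
  by rewrite lerDl ltW// mulr_gt0.
rewrite mulrDr mulr1; lra.
Qed.

(** Bernoulli's inequality for convex powers: invert [powR_le_tangent] and use
1 / (1 - u) >= 1 + u. *)
Lemma powRN_ge_tangent s t : -1 < s -> s <= 0 -> 0 < t ->
  1 + s * (t - 1) <= t `^ s.
Proof.
move=> s1; rewrite le_eqVlt => /predU1P[->|s0] t0; first by rewrite powRr0; lra.
have [neg|pos] := leP (1 + s * (t - 1)) 0.
  exact: le_trans neg (powR_ge0 _ _).
have ns0 : 0 < - s by lra.
have ns1 : - s <= 1 by lra.
have := powR_le_tangent ns0 ns1 (ltW t0).
rewrite powRN => H.
have tp : 0 < t `^ s by exact: powR_gt0.
have pos' : 0 < 1 + - s * (t - 1) by apply: lt_le_trans H; rewrite invr_gt0.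
rewrite -[leRHS]invrK.
apply: (@le_trans _ _ (1 + - s * (t - 1))^-1); last first.
  by rewrite lef_pV2 ?posrE ?invr_gt0.
rewrite -[leRHS]mul1r ler_pdivlMr//.
have := sqr_ge0 (s * (t - 1)); rewrite expr2; nra.
Qed.

Lemma ge0_derive_le (f df : R -> R) b : 0 <= b ->
  (forall t, 0 <= t <= b -> is_derive t 1 f (df t)) ->
  (forall t, 0 <= t <= b -> 0 <= df t) -> f 0 <= f b.
Proof.
move=> b0 fdf df0.
have d1 t : t \in `]0, b[ -> is_derive t 1 f (df t).
  by rewrite in_itv/= => /andP[t0 tb]; apply: fdf; rewrite !ltW.
have cf : {within `[0, b], continuous f}.
  apply: derivable_within_continuous => t; rewrite in_itv/= => tb.
  by have [] := fdf _ tb.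
have [c cb fE] := MVT_segment b0 d1 cf.
rewrite in_itv/= in cb.
by rewrite -subr_ge0 fE subr0 mulr_ge0// df0.
Qed.

Lemma is_derive_powR1D c q t : 0 < 1 + c * t ->
  is_derive t 1 (fun u : R => (1 + c * u) `^ q)
    (q * (1 + c * t) `^ (q - 1) * c).
Proof.
move=> ct.
have dg : is_derive t (1 : R) (fun u : R => 1 + c * u) c.
  have : is_derive t (1 : R) (cst (1 : R) + c \*: id) (0 + c *: (1 : R)).
    exact: is_deriveD.
  by rewrite add0r /GRing.scale/= mulr1.
have dp := is_derive1_powR q ct.
exact: (is_derive1_comp (f := fun x : R => x `^ q)
  (g := fun u : R => 1 + c * u) dp dg).
Qed.

(** The e-derivative of the right side minus the left side is
q ((1 + e) ^ (q-1) + (1 - e) ^ (q-1) - 2).  It is nonnegative: in the tangent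
bounds for the convex power q - 1 the linear terms cancel. *)
Lemma powR_sub_ge q e : 0 < q -> q <= 1 -> 0 <= e -> e < 1 ->
  2 * q * e <= (1 + e) `^ q - (1 - e) `^ q.
Proof.
move=> q0 q1 e0 e1.
(* The coefficients 1 and -1 match the form of the derivative lemma. *)
pose f t := (1 + 1 * t) `^ q - (1 + -1 * t) `^ q - 2 * q * t.
pose df t := q * (1 + 1 * t) `^ (q - 1) + q * (1 + -1 * t) `^ (q - 1) - 2 * q.
have : f 0 <= f e.
  apply: (@ge0_derive_le f df) => // t /andP[t0 te].
    have dp := @is_derive_powR1D 1 q t ltac:(lra).
    have dm := @is_derive_powR1D (-1) q t ltac:(lra).
    have dl : is_derive t (1 : R) ((2 * q) \*: (id : R -> R))
        ((2 * q) *: (1 : R)).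
      exact: is_deriveZ.
    apply: is_derive_eq (is_deriveB (is_deriveB dp dm) dl) _.
    by rewrite /df /GRing.scale/=; ring.
  rewrite /df.
  have q1' : -1 < q - 1 by lra.
  have q1'' : q - 1 <= 0 by lra.
  have := @powRN_ge_tangent _ (1 + 1 * t) q1' q1''.
  have := @powRN_ge_tangent _ (1 + -1 * t) q1' q1''.
  move=> /(_ ltac:(lra)) H1 /(_ ltac:(lra)) H2.
  nra.
rewrite /f !mulr0 !addr0 subr0 subrr mul1r mulN1r; lra.
Qed.

(** Second-order lower bound for the symmetric sum: its e-derivative is p times
the difference bounded by [powR_sub_ge] for the power p - 1. *)
Lemma powR_add_ge p e : 1 < p -> p <= 2 -> 0 <= e -> e < 1 ->
  2 + p * (p - 1) * e ^+ 2 <= (1 + e) `^ p + (1 - e) `^ p.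
Proof.
move=> p1 p2 e0 e1.
pose f t := (1 + 1 * t) `^ p + (1 + -1 * t) `^ p - (p * (p - 1)) * t ^+ 2.
pose df t := p * (1 + t) `^ (p - 1) - p * (1 - t) `^ (p - 1)
   - (p * (p - 1)) * (2 * t).
have : f 0 <= f e.
  apply: (@ge0_derive_le f df) => // t /andP[t0 te].
    have dp := @is_derive_powR1D 1 p t ltac:(lra).
    have dm := @is_derive_powR1D (-1) p t ltac:(lra).
    have d2 : is_derive t (1 : R) ((id : R -> R) ^+ 2)
        ((2 * t ^+ 1) *: (1 : R)).
      exact: is_deriveX.
    have dl := is_deriveZ (p * (p - 1)) d2.
    apply: is_derive_eq (is_deriveB (is_deriveD dp dm) dl) _.
    by rewrite /df /GRing.scale/= mul1r mulN1r; ring.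
  rewrite /df.
  have := @powR_sub_ge (p - 1) t ltac:(lra) ltac:(lra) t0 ltac:(lra).
  nra.
rewrite /f !mulr0 !addr0 expr0n/= mulr0 subr0 mul1r mulN1r !powR1; lra.
Qed.

End PowerInequalities.

(** * Moments of positive vectors *)

Section Moments.
Variable R : realType.
Implicit Types p q a : R.

Definition moment d (x : 'I_d -> R) q := d%:R^-1 * \sum_i x i `^ q.

(** The Beckner inequality with the trace functionals replaced by moments of the
spectrum and the common factor p / (p - 1) divided out. *)
Definition moment_beckner d p a := forall x : 'I_d -> R, (forall i, 0 < x i) ->
  a * (moment x p - moment x 1 `^ p)
    <= p / 4 * (moment x p - moment x 1 * moment x (p - 1)).

Lemma moment_ge0 d (x : 'I_d -> R) q : 0 <= moment x q.
Proof.
by rewrite mulr_ge0 ?invr_ge0 ?ler0n// sumr_ge0// => i _; rewrite powR_ge0.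
Qed.

Lemma moment_gt0 d (x : 'I_d.+1 -> R) q : (forall i, 0 < x i) -> 0 < moment x q.
Proof.
move=> x0; rewrite mulr_gt0 ?invr_gt0 ?ltr0n// big_ord_recl.
by rewrite ltr_wpDr ?powR_gt0// sumr_ge0// => i _; rewrite powR_ge0.
Qed.

(** Jensen's inequality for a concave power: sum the tangent bound at the mean. *)
Lemma moment_le_powR d (x : 'I_d.+1 -> R) q : 0 < q -> q <= 1 ->
  (forall i, 0 < x i) -> moment x q <= moment x 1 `^ q.
Proof.
move=> q0 q1 x0; set M := moment x 1.
have M0 : 0 < M by exact: moment_gt0.
have d0 : 0 < d.+1%:R :> R by rewrite ltr0n.
have tg i : x i `^ q <= M `^ q * (1 + q * (x i / M - 1)).
  have t0 : 0 <= x i / M by rewrite divr_ge0 ?(ltW (x0 i)) ?(ltW M0).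
  have xE : x i = M * (x i / M) by rewrite mulrC divfK ?gt_eqF.
  rewrite {1}xE (powRM _ (ltW M0) t0) ler_pM2l ?powR_gt0//.
  exact: powR_le_tangent.
rewrite /moment ler_pdivrMl//.
apply: (le_trans (ler_sum _ (fun i _ => tg i))).
rewrite -mulr_sumr big_split/= -mulr_sumr sumrB -mulr_suml.
rewrite sumr_const card_ord.
have -> : \sum_(i < d.+1) x i = d.+1%:R * M.
  rewrite /M /moment mulVKf ?gt_eqF//; apply: eq_bigr => i _.
  by rewrite powRr1// ltW.
by rewrite mulfK ?gt_eqF// subrr mulr0 addr0 mulrC.
Qed.

End Moments.

(** * Reduction of the Beckner inequality to the spectrum *)

Section Conjugation.
Variables (F : comUnitRingType) (n : nat).
Implicit Types P D : 'M[F]_n.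

Lemma mul_conj_diag_mx P (u v : 'rV[F]_n) : P \in unitmx ->
  (invmx P *m diag_mx u *m P) *m (invmx P *m diag_mx v *m P) =
  invmx P *m diag_mx (\row_i (u 0 i * v 0 i)) *m P.
Proof.
by move=> uP; rewrite !mulmxA mulmxK// -(mulmxA (invmx P)) mulmx_diag.
Qed.

Lemma mxtrace_conj P D : P \in unitmx -> \tr (invmx P *m D *m P) = \tr D.
Proof. by move=> uP; rewrite mxtrace_mulC mulmxA mulmxV// mul1mx. Qed.

Lemma char_poly_conj P D : P \in unitmx ->
  char_poly (invmx P *m D *m P) = char_poly D.
Proof.
move=> uP; rewrite /char_poly.
have -> : char_poly_mx (invmx P *m D *m P) =
   map_mx polyC (invmx P) *m char_poly_mx D *m map_mx polyC P.
  rewrite /char_poly_mx mulmxBr mulmxBl !map_mxM; congr (_ - _).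
  by rewrite scalar_mxC -mulmxA -map_mxM mulVmx// map_mx1 mulmx1.
rewrite !det_mulmx mulrAC -det_mulmx -map_mxM mulVmx// map_mx1 det1.
exact: mul1r.
Qed.

End Conjugation.

Section Spectrum.
Local Open Scope complex_scope.
Local Open Scope sesquilinear_scope.

Variables (R : realType) (d : nat).
Implicit Types (X : 'M[R[i]]_d) (p q : R) (x : 'I_d -> R).

(** On Hermitian X the spectral entries are real, so taking real parts is
faithful; see [spectral_diagE]. *)
Definition eigval X i : R := complex.Re (spectral_diag X 0 i).

Lemma ntr_conj_diag (P : 'M[R[i]]_d) (D : 'rV[R[i]]_d) : P \in unitmx ->
  ntr (invmx P *m diag_mx D *m P) = d%:R^-1 * \sum_i complex.Re (D 0 i).
Proof.
move=> uP; rewrite /ntr mxtrace_conj// mxtrace_diag.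
by rewrite raddf_sum.
Qed.

Lemma ntr_mxpowR X q : ntr (mxpowR X q) = moment (eigval X) q.
Proof.
rewrite ntr_conj_diag ?spectral_unit//.
by congr (_ * _); apply: eq_bigr => i _; rewrite mxE.
Qed.

Lemma spectral_diagE X i : X \is hermsymmx ->
  spectral_diag X 0 i = (eigval X i)%:C.
Proof.
move=> /hermitian_spectral_diag_real/mxOverP/(_ 0 i).
rewrite /eigval; case: (spectral_diag X 0 i) => u v.
by rewrite realE !lecE/= => /orP[] /andP[/eqP E _]; rewrite (E, esym E).
Qed.

(** With P the diagonalizing unitary, the i-th eigenvalue is the quadratic form
of X at the adjoint of the i-th row of P, a vector of norm 1. *)
Lemma posdefmx_eigval_gt0 X i : posdefmx X -> 0 < eigval X i.
Proof.
move=> [hX pX]; set P := spectralmx X.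
have uP : P \is unitarymx by exact: spectral_unitarymx.
have XE : P *m X *m P^t* = diag_mx (spectral_diag X).
  have /orthomx_spectralP {1}-> := hermitian_normalmx hX.
  rewrite -/P -invmx_unitary// !mulmxA mulmxV ?unitarymx_unit// mul1mx.
  by rewrite mulmxK ?unitarymx_unit.
have wE : ((row i P)^t*)^t* = row i P.
  by apply/rowP => j; rewrite !mxE conjCK.
have cE : (row i P)^t* = col i (P^t*) by apply/colP => j; rewrite !mxE.
have := pX ((row i P)^t*); rewrite wE cE.
have dE (M : 'M[R[i]]_d) :
    row i P *m M *m col i (P^t*) = row i (col i (P *m M *m P^t*)).
  by rewrite !rowE !colE !mulmxA.
rewrite dE XE !mxE eqxx mulr1n spectral_diagE// ltcR; apply.
apply/eqP => v0; have : row i P *m col i (P^t*) = 1%:M.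
  rewrite -[row i P]mulmx1 dE mulmx1 (unitarymxP uP).
  by apply/matrixP => k l; rewrite !mxE !ord1 !eqxx.
rewrite v0 mulmx0 => /matrixP/(_ 0 0); rewrite !mxE eqxx => /eqP.
by rewrite eq_sym oner_eq0.
Qed.

(** X ^ (p-1) and X are diagonalized by the same matrix, so their product has
trace the sum of the x_i ^ p, while the scalar part of [Ldepol] contributes the
mean of X times the trace of X ^ (p-1). *)
Lemma ntr_mxpowR_Ldepol X p : posdefmx X -> 1 < p ->
  ntr (mxpowR X (p - 1) *m Ldepol R d X) =
  moment (eigval X) 1 * moment (eigval X) (p - 1) - moment (eigval X) p.
Proof.
move=> pX p1; have hX := pX.1.
(* [spectralmx X] mentions X, so the diagonalizing matrix is made abstract
   before X is expanded. *)
have [P uP [pE XE]] : exists2 P : 'M[R[i]]_d, P \in unitmx &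
   (forall q,
      mxpowR X q = invmx P *m diag_mx (\row_i (eigval X i `^ q)%:C) *m P) /\
   X = invmx P *m diag_mx (\row_i (eigval X i)%:C) *m P.
  exists (spectralmx X); first exact: spectral_unit.
  have rowE : \row_i (eigval X i)%:C = spectral_diag X.
    by apply/rowP => i; rewrite mxE spectral_diagE.
  split; last first.
    by rewrite rowE; exact/orthomx_spectralP/hermitian_normalmx.
  move=> q; apply: (congr1 (fun D =>
    invmx (spectralmx X) *m diag_mx D *m spectralmx X)).
  by apply/rowP => i; rewrite !mxE.
have trX : \tr X = (\sum_i eigval X i `^ 1)%:C.
  rewrite {1}XE mxtrace_conj// mxtrace_diag.
  rewrite rmorph_sum/=; apply: eq_bigr => i _; rewrite mxE powRr1// ltW//.
  exact: posdefmx_eigval_gt0.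
pose Y := invmx P *m diag_mx (\row_i ((eigval X i `^ p)%:C)) *m P.
have YE : mxpowR X (p - 1) *m X = Y.
  apply: etrans (congr2 mulmx (pE (p - 1)) XE) _.
  apply: etrans (mul_conj_diag_mx _ _ uP) _.
  apply: (congr1 (fun D => invmx P *m diag_mx D *m P)).
  apply/rowP => i; rewrite !mxE -rmorphM/= mulrC mulr_powRB1//; last by lra.
  by rewrite ltW// posdefmx_eigval_gt0.
have ntrY : ntr Y = moment (eigval X) p.
  rewrite /Y ntr_conj_diag//; congr (_ * _).
  by apply: eq_bigr => i _; rewrite mxE.
have ReM a (z : R[i]) : complex.Re (a%:C * z) = a * complex.Re z.
  by case: z => u v /=; rewrite mul0r subr0.
have dE : (d%:R^-1 : R[i]) = (d%:R^-1)%:C by rewrite fmorphV rmorph_nat.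
have trL c (A : 'M[R[i]]_d) :
    \tr (A *m (c%:M - X)) = c * \tr A - \tr (A *m X).
  by rewrite mulmxBr mul_mx_scalar -mxtraceZ -raddfB.
have ReB (z w : R[i]) : complex.Re (z - w) = complex.Re z - complex.Re w.
  by case: z w => ? ? [].
rewrite /ntr trL ReB YE mxtraceZ trX dE -rmorphM ReM.
rewrite -(ntr_mxpowR _ (p - 1)) -ntrY.
rewrite -[moment (eigval X) 1]/(_ * _).
by rewrite mulrBr mulrCA.
Qed.

Lemma real_complexC (u : R) : u%:C \is (@Num.real R[i]).
Proof. by rewrite realE !lecE/= eqxx/=; exact: le_total. Qed.

Lemma hermsymmx_diag (v : 'rV[R[i]]_d) : v \is a mxOver Num.real ->
  diag_mx v \is hermsymmx.
Proof.
move=> vR; apply: realsym_hermsym.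
  by apply/is_hermitianmxP; rewrite expr0 scale1r map_mx_id// tr_diag_mx.
apply/mxOverP => i j; rewrite !mxE.
by case: eqP => _; rewrite ?mulr0n ?mulr1n ?real0//; exact: (mxOverP vR).
Qed.

(** The order in which [spectral_diag] lists the eigenvalues is unspecified, but
the characteristic polynomial determines them with multiplicity. *)
Lemma spectral_diag_diag_mx (v : 'rV[R[i]]_d) : v \is a mxOver Num.real ->
  perm_eq [seq v 0 i | i <- index_enum 'I_d]
    [seq spectral_diag (diag_mx v) 0 i | i <- index_enum 'I_d].
Proof.
move=> vR; set A := diag_mx v.
have hA : A \is hermsymmx by exact: hermsymmx_diag.
have uP := spectral_unit A.
have charE w : char_poly (diag_mx w) =
    \prod_(x <- [seq w 0 i | i <- index_enum 'I_d]) ('X - x%:P) :> {poly R[i]}.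
  rewrite char_poly_trig ?diag_mx_is_trig// big_map.
  by apply: eq_bigr => i _; rewrite mxE eqxx mulr1n.
apply: prod_XsubC_eq; rewrite -!charE -/A.
have /orthomx_spectralP {1}-> := hermitian_normalmx hA.
by rewrite char_poly_conj.
Qed.

Definition diagR x : 'M[R[i]]_d := diag_mx (\row_i (x i)%:C).

Lemma moment_eigval_diagR x q : moment (eigval (diagR x)) q = moment x q.
Proof.
have vR : \row_i (x i)%:C \is a mxOver Num.real.
  by apply/mxOverP => j k; rewrite mxE; exact: real_complexC.
have := perm_big _ (spectral_diag_diag_mx vR) (op := +%R) (x := 0) (P := xpredT)
  (F := fun z : R[i] => complex.Re z `^ q).
rewrite !big_map/= => E; congr (_ * _); rewrite -E.
by apply: eq_bigr => i _; rewrite mxE.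
Qed.

Lemma posdefmx_diagR x : (forall i, 0 < x i) -> posdefmx (diagR x).
Proof.
move=> x0; split.
  apply: hermsymmx_diag; apply/mxOverP => j k; rewrite mxE.
  exact: real_complexC.
move=> v v0; have /existsP[i vi] : [exists i, v i 0 != 0].
  rewrite -negb_forall; apply: contra v0 => /forallP v0.
  by apply/eqP/colP => i; rewrite mxE; apply/eqP.
have termE j : (v^t* *m diagR x) 0 j * v j 0 = (x j)%:C * `|v j 0| ^+ 2.
  by rewrite mul_mx_diag !mxE normCK mulrAC mulrC (mulrC (v j 0)).
have xC0 j : 0 < (x j)%:C by rewrite ltcR.
rewrite mxE (bigD1 i)//= ltr_wpDr//.
  apply: sumr_ge0 => j _; rewrite termE mulr_ge0 ?exprn_ge0//; exact: ltW.
by rewrite termE mulr_gt0 ?exprn_gt0 ?normr_gt0.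
Qed.

Lemma beckner_ineqE X p a : posdefmx X -> 1 < p ->
  (a * conj_exp p * (pnorm p X `^ p - pnorm 1 X `^ p)
     <= dirichlet_form p (Ldepol R d) X) =
  (a * (moment (eigval X) p - moment (eigval X) 1 `^ p) <=
   p / 4 * (moment (eigval X) p -
            moment (eigval X) 1 * moment (eigval X) (p - 1))).
Proof.
move=> pX p1.
have c0 : 0 < conj_exp p by rewrite divr_gt0; lra.
have pE q : pnorm q X `^ p = moment (eigval X) q `^ (q^-1 * p).
  by rewrite powRrM -ntr_mxpowR.
(* Naming the norms keeps unification from unfolding the spectral
   decomposition inside them. *)
rewrite /dirichlet_form (ntr_mxpowR_Ldepol pX p1).
move: (pE p) (pE 1); move: (pnorm p X) (pnorm 1 X) => u v -> ->.
rewrite mulVf ?gt_eqF ?(lt_trans _ p1)// invr1 mul1r powRr1 ?moment_ge0//.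
rewrite -[in RHS](ler_pM2l c0); congr (_ <= _); ring.
Qed.

Lemma beckner_setE p a : 1 < p ->
  beckner_set p (Ldepol R d) a <-> moment_beckner d p a.
Proof.
move=> p1; split=> [H x x0|H X pX].
  have := H _ (posdefmx_diagR x0).
  by rewrite beckner_ineqE ?moment_eigval_diagR//; exact: posdefmx_diagR.
rewrite beckner_ineqE//; apply: H => i; exact: posdefmx_eigval_gt0.
Qed.

End Spectrum.

(** * Admissible constants *)

Section Bounds.
Variable R : realType.
Implicit Types p a : R.

Lemma moment_beckner_p4 d p : 1 < p -> p <= 2 -> moment_beckner d.+1 p (p / 4).
Proof.
move=> p1 p2 x x0.
have M0 := moment_gt0 1 x0.
rewrite ler_pM2l; last by lra.
rewrite lerD2l lerN2 -(@mulr_powRB1 _ (moment x 1)) ?(ltW M0)//; last by lra.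
by rewrite ler_pM2l// moment_le_powR//; lra.
Qed.

(** Near the identity both sides are quadratic in the deviation, and comparing
their leading coefficients gives 1/2; the test vector (1 + e, 1 - e, 1, ..., 1)
keeps the mean at 1. *)
Lemma moment_beckner_le_half d p a : 1 < p -> p <= 2 ->
  moment_beckner d.+2 p a -> a <= 1 / 2.
Proof.
move=> p1 p2 H; rewrite leNgt; apply/negP => a2.
(* The test vector yields 4 a (1 - e) <= 2 - e, that is 4 a - 2 <= e (4 a - 1);
   this e makes the right side half of the left one. *)
pose e := (4 * a - 2) / (2 * (4 * a - 1)).
have a0 : 0 < 4 * a - 1 by lra.
have eE : e * (2 * (4 * a - 1)) = 4 * a - 2 by rewrite divfK// gt_eqF//; lra.
have e0 : 0 < e by rewrite divr_gt0; lra.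
have e1 : e < 1 by nra.
pose x (i : 'I_d.+2) : R :=
  if i == ord0 then 1 + e else if i == lift ord0 ord0 then 1 - e else 1.
have xE q : moment x q = d.+2%:R^-1 * ((1 + e) `^ q + (1 - e) `^ q + d%:R).
  rewrite /moment !big_ord_recl/= addrA; congr (_ * (_ + _)).
  rewrite (eq_bigr (fun=> 1)); last by move=> i _; rewrite /x/= powR1.
  by rewrite sumr_const card_ord.
have n0 : 0 < d.+2%:R :> R by rewrite ltr0n.
have x1 : moment x 1 = 1.
  rewrite xE !powRr1; [|lra..].
  rewrite (_ : 1 + e + (1 - e) + d%:R = d.+2%:R) ?mulVf ?gt_eqF//.
  by rewrite -addn2 natrD; lra.
have xpos i : 0 < x i by rewrite /x; case: ifP => _; [|case: ifP => _]; lra.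
have := H x xpos; rewrite x1 powR1 mul1r !xE.
set u := d%:R; set n := d.+2%:R.
have -> : n^-1 * ((1 + e) `^ p + (1 - e) `^ p + u) - 1 =
   n^-1 * ((1 + e) `^ p + (1 - e) `^ p - 2).
  have nE : n = u + 2 by rewrite /n -addn2 natrD.
  by rewrite nE; field; rewrite -nE gt_eqF.
rewrite -mulrBr mulrCA [leRHS]mulrCA ler_pM2l ?invr_gt0//.
have r0 : 0 < p - 1 by lra.
have r1 : p - 1 <= 1 by lra.
rewrite -[in leRHS](@mulr_powRB1 _ (1 + e) p); [|lra..].
rewrite -[in leRHS](@mulr_powRB1 _ (1 - e) p); [|lra..].
have lo := powR_add_ge p1 p2 (ltW e0) e1.
have up := powR_sub_le r0 r1 e0 e1.
move: lo up; set D := _ `^ p + _ `^ p.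
set U := _ `^ (p - 1); set V := _ `^ (p - 1) => lo up {}H.
pose k := p * (p - 1) * e ^+ 2.
have k0 : 0 < k.
  by rewrite /k; apply: mulr_gt0; [apply: mulr_gt0; lra|exact: exprn_gt0].
set w := (1 - e)^-1 in up.
have wE : w * (1 - e) = 1 by rewrite mulVf// gt_eqF//; lra.
have lower : a * k <= a * (D - 2).
  by rewrite ler_pM2l ?lerBrDl//; lra.
have upper : p / 4 * ((1 + e) * U + (1 - e) * V + u - (U + V + u)) <=
    k * ((1 + w) / 4).
  have -> : k * ((1 + w) / 4) = p / 4 * (e * ((p - 1) * e * (1 + w))).
    by rewrite /k; field.
  rewrite ler_pM2l; last by lra.
  rewrite [leLHS](_ : _ = e * (U - V)); last by ring.
  by rewrite ler_pM2l.
have : a <= (1 + w) / 4.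
  by rewrite -(ler_pM2l k0) mulrC (le_trans lower)// (le_trans H).
nra.
Qed.

(** Test vector (1, dl, ..., dl) with total small mass eta = (d - 1) dl.  The
powers of 1 + eta are bounded by (1 + eta) ^ 2, and the bound a <= 1/2 controls
the resulting error on the left. *)
Lemma moment_beckner_le_near_rank1 d p a : 1 < p -> p <= 2 ->
  moment_beckner d.+2 p a ->
  a <= p * d.+2%:R `^ (p - 1) / (4 * (d.+2%:R `^ (p - 1) - 1)).
Proof.
move=> p1 p2 H.
have a2 := moment_beckner_le_half p1 p2 H.
set n : R := d.+2%:R; set D := n `^ (p - 1).
have n2 : 2 <= n by rewrite ler_nat.
have D1 : 1 < D.
  have : 1 `^ (p - 1) < D by apply: gt0_ltr_powR; rewrite ?nnegrE; lra.
  by rewrite powR1.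
rewrite ler_pdivlMr; last by lra.
have [a0|a0] := leP a 0; first by nra.
(* After multiplication by n D the right side is at most
   p D / 4 * (1 - 6 eta - 7 eta ^ 2), because 1 / n = 7 eta.  Replacing
   (1 + eta) ^ 2 by 1 on the left costs a (2 eta + eta ^ 2), which is at most
   eta + eta ^ 2 / 2 and hence absorbed. *)
pose eta := (7 * n)^-1; pose dl := eta / (n - 1).
have etaE : eta * (7 * n) = 1 by rewrite mulVf// gt_eqF//; lra.
have eta0 : 0 < eta by rewrite invr_gt0; lra.
have dlE : dl * (n - 1) = eta by rewrite divfK// gt_eqF//; lra.
have dl0 : 0 < dl by rewrite divr_gt0//; lra.
have dl1 : dl <= 1 by nra.
pose x (i : 'I_d.+2) : R := if i == ord0 then 1 else dl.
have xpos i : 0 < x i by rewrite /x; case: ifP => _; lra.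
have xE q : moment x q = n^-1 * (1 + (n - 1) * dl `^ q).
  rewrite /moment big_ord_recl/= powR1; congr (_ * (_ + _)).
  rewrite (eq_bigr (fun=> dl `^ q))// sumr_const card_ord -[LHS]mulr_natl.
  by congr (_ * _); rewrite /n -[d.+2]addn1 natrD addrK.
have := H x xpos.
rewrite !xE (powRr1 (ltW dl0)) (mulrC (n - 1) dl) dlE.
have dp : dl `^ p <= dl by rewrite ge1r_powR ?dl0//; lra.
set s := (n - 1) * dl `^ p; set t := (n - 1) * dl `^ (p - 1).
have s0 : 0 <= s by rewrite mulr_ge0 ?powR_ge0//; lra.
have s1 : s <= eta by rewrite -dlE [leRHS]mulrC ler_pM2l//; lra.
have t0 : 0 <= t by rewrite mulr_ge0 ?powR_ge0//; lra.
have nvE : n^-1 = 7 * eta by rewrite /eta invfM mulVKf// gt_eqF.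
have n0 : 0 < n by lra.
have DV : n^-1 `^ (p - 1) = D^-1.
  by rewrite -(powR_inv1 (ltW n0)) -powRrM mulN1r powRN.
have QE : (n^-1 * (1 + eta)) `^ p = n^-1 * (D^-1 * (1 + eta) `^ p).
  rewrite powRM ?invr_ge0//; [|lra..].
  rewrite -(@mulr_powRB1 _ n^-1) ?invr_ge0//; [|lra..].
  by rewrite -mulrA DV.
have Q2 : (1 + eta) `^ p <= (1 + eta) ^+ 2.
  by rewrite -powR_mulrn ?ler_powR//; lra.
rewrite QE; set W := (1 + eta) `^ p in Q2 *.
rewrite [leLHS](_ : _ = n^-1 * (a * (1 + s - D^-1 * W))); last by ring.
rewrite [leRHS](_ : _ = n^-1 *
    (p / 4 * (1 + s - (1 + eta) * (n^-1 * (1 + t))))); last by ring.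
rewrite ler_pM2l ?invr_gt0// => {}H.
have D0 : 0 < D by lra.
have lo : a * (1 - D^-1 * (1 + eta) ^+ 2) <= a * (1 + s - D^-1 * W).
  rewrite ler_pM2l// lerD ?lerN2 ?ler_pM2l ?invr_gt0//; lra.
have up : p / 4 * (1 + s - (1 + eta) * (n^-1 * (1 + t))) <=
    p / 4 * (1 - 6 * eta - 7 * eta ^+ 2).
  rewrite ler_pM2l; last by lra.
  rewrite nvE; nra.
have := le_trans lo (le_trans H up).
rewrite -(ler_pM2l D0).
have -> : D * (a * (1 - D^-1 * (1 + eta) ^+ 2)) = a * (D - (1 + eta) ^+ 2).
  by field; rewrite gt_eqF.
have e2 : 0 < eta ^+ 2 by rewrite exprn_gt0.
have slack : 4 * a * (2 * eta + eta ^+ 2) <= 2 * (2 * eta + eta ^+ 2).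
  by rewrite ler_pM2r; lra.
have pD : 1 <= p * D by nra.
have slack' : 1 * (6 * eta + 7 * eta ^+ 2) <= p * D * (6 * eta + 7 * eta ^+ 2).
  by rewrite ler_pM2r//; lra.
move: slack slack'; rewrite !expr2; nra.
Qed.

End Bounds.

Theorem proposition3p30 (R : realType) (d : nat) (p : R) :
  (2 <= d)%N -> 1 < p -> p <= 2 ->
  exists alpha : R,
    optimal_beckner_constant p (Ldepol R d) alpha /\
    p / 4 <= alpha /\
    alpha <= Num.min (1 / 2)
               (p * d%:R `^ (p - 1) / (4 * (d%:R `^ (p - 1) - 1))).
Proof.
case: d => [|[|d]]// _ p1 p2.
pose S : set R := beckner_set p (Ldepol R d.+2).
have SE a : S a <-> moment_beckner d.+2 p a by exact: beckner_setE.
have Sp : S (p / 4) by apply/SE; exact: moment_beckner_p4.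
have Su : ubound S (1 / 2) by move=> a /SE; exact: moment_beckner_le_half.
have supS : has_sup S by split; [exists (p / 4)|exists (1 / 2)].
have ubS : ubound S (sup S) by exact: ub_le_sup supS.2.
exists (sup S); split; [split=> //|split].
- apply/SE => x x0.
  set A := _ - _; set B := p / 4 * _.
  have HS a : S a -> a * A <= B by move=> /SE/(_ x x0).
  (* When A <= 0 the constraint bounds a from below, and p / 4 meets it. *)
  have [A0|A0] := leP A 0.
    by apply: le_trans (HS _ Sp); rewrite ler_wnM2r// ubS.
  rewrite -ler_pdivlMr//; apply: ge_sup; first exact: supS.1.
  by move=> a /HS; rewrite ler_pdivlMr.
- exact: ubS.
- rewrite le_min; apply/andP; split; apply: ge_sup => //; try exact: supS.1.
  move=> a /SE; exact: moment_beckner_le_near_rank1.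
Qed.
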